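(* For every real $x>0$, the following infinite product converges and $$\Gamma(x)=\frac1x\prod_{n=1}^{\infty}\prod_{k=1}^{n}(k!)^{(-1)^{k+n}\binom{x}{n}\binom{n}{k}}=\frac1x\left(\frac21\right)^{\binom{x}{2}}\left(\frac34\right)^{\binom{x}{3}}\left(\frac{32}{27}\right)^{\binom{x}{4}}\cdots,$$ where the displayed factors after $\frac1x$ are the inner products for $n=2,3,4$ (the factor for $n=1$ is $1$).
   Context: $\Gamma$ is the gamma function. For real $x$ and integer $n\ge 0$, $\binom{x}{n}=\frac{x(x-1)\cdots(x-n+1)}{n!}$. The infinite product over $n$ is understood as the limit of the partial products $\prod_{n=1}^{N}\prod_{k=1}^{n}$ as $N\to\infty$. *)

(* Defs.v *)
From HB Require Import structures.
From mathcomp Require Import all_boot all_order all_algebra.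
From mathcomp Require Import all_classical all_reals all_analysis.
Set Implicit Arguments.
Unset Strict Implicit.
Unset Printing Implicit Defensive.
Import Order.TTheory GRing.Theory Num.Theory.
Import numFieldNormedType.Exports.
Local Open Scope classical_set_scope.
Local Open Scope ring_scope.

(* Euler's integral of the second kind; it is Gamma only for 0 < x, since
   [Rintegral] returns 0 when the integral diverges. *)
Definition Gamma (R : realType) (x : R) : R :=
  \int[@lebesgue_measure R]_(t in `]0, +oo[) (t `^ (x - 1) * expR (- t)).

Definition rbinom (R : realType) (x : R) (n : nat) : R :=
  (\prod_(0 <= i < n) (x - i%:R)) / (n`!)%:R.

Definition inner_prod (R : realType) (x : R) (n : nat) : R :=
  \prod_(1 <= k < n.+1)
    (k`!)%:R `^ ((-1) ^+ (k + n) * rbinom x n * 'C(n, k)%:R).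

Definition partial_prod (R : realType) (x : R) (N : nat) : R :=
  \prod_(1 <= n < N.+1) inner_prod x n.

(* Main.v *)
Require Import Defs.
From HB Require Import structures.
From mathcomp Require Import all_boot all_order all_algebra.
From mathcomp Require Import all_classical all_reals all_analysis.
From mathcomp Require Import measurable_realfun ring lra.
Set Implicit Arguments.
Unset Strict Implicit.
Unset Printing Implicit Defensive.
Import Order.TTheory GRing.Theory Num.Theory.
Import numFieldNormedType.Exports.
Local Open Scope classical_set_scope.
Local Open Scope ring_scope.

(** The product is the exponential of a Newton series.  With G = ln Gamma, the
    number G (1 + k) is ln k!, so the logarithm of the n-th factor is
    rbinom x n times the n-th forward difference of G at 1, and the logarithm
    of the N-th partial product is the degree N Newton interpolation of G at
    the nodes 1, 2, ..., N + 1, evaluated at 1 + x.  It has to be shown that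
    the remainder of this interpolation tends to 0: the product then tends to
    Gamma (1 + x) = x * Gamma x.

    The remainder is reached from the function y |-> 1 / y, for which it is a
    closed rational expression in the base point a (newton_rem_inv).  Taking
    remainders commutes with derivation in a, so this expression is the
    derivative of the remainder of ln; since the latter vanishes as a tends to
    infinity, it is bounded by C / a ^ 2, where C = |rbinom x (N + 1)|
    (newton_rem_ln_le).  Taking remainders also commutes with the difference
    operator, and G (y + 1) - G y = ln y, so the remainder of G at 1 is the sum
    over a = 1, 2, 3, ... of minus the remainders of ln at a, and is at most
    2 * C (newton_rem_sum_le).  Finally C tends to 0 because x > 0
    (rbinom_cvg0).

    The telescoping requires the remainder of G to vanish at infinity, that is,
    G (s + x) - G s - x * ln s to tend to 0.  As in the theorem of Bohr and
    Mollerup, this follows from the difference equation and the one-sided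
    estimate Gamma (s + x) <= s ^ x * Gamma s for 0 <= x <= 1
    (Gamma_addr_le), a consequence of the concavity of t |-> t ^ x.  The
    functional equation itself is an integration by parts on compact
    intervals that exhaust the positive half-line. *)

(** * Forward differences and Newton interpolation *)

Fixpoint fdiff (R : realType) (f : R -> R) (n : nat) (a : R) : R :=
  if n is m.+1 then fdiff f m (a + 1) - fdiff f m a else f a.

Definition newton (R : realType) (f : R -> R) (N : nat) (x a : R) : R :=
  \sum_(n < N.+1) rbinom x n * fdiff f n a.

Definition newton_rem (R : realType) (f : R -> R) (N : nat) (x a : R) : R :=
  f (a + x) - newton f N x a.

Definition rising (R : realType) (n : nat) (a : R) : R :=
  \prod_(i < n) (a + i%:R).

Section finite_differences.
Context {R : realType}.
Implicit Types (f g : R -> R) (n N : nat) (a x : R).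

(** Equality is required on the positive half-line only, because the relations
    between Gamma and ln fail outside it. *)
Lemma eq_fdiff f g n a : 0 < a -> (forall y, 0 < y -> f y = g y) ->
  fdiff f n a = fdiff g n a.
Proof.
move=> + fg; elim: n a => [|n IHn] a a0 /=; first exact: fg.
by rewrite !IHn// addr_gt0.
Qed.

Lemma fdiff_diff f n a :
  fdiff (fun y => f (y + 1) - f y) n a = fdiff f n.+1 a.
Proof. by elim: n a => [//|n IHn] a /=; rewrite !IHn. Qed.

Lemma fdiffE f n a :
  fdiff f n a = \sum_(k < n.+1) (-1) ^+ (k + n) * 'C(n, k)%:R * f (a + k%:R).
Proof.
elim: n a => [|n IHn] a /=.
  by rewrite big_ord_recl big_ord0 expr0 bin0 !mul1r !addr0.
rewrite !IHn.
rewrite [in RHS]big_ord_recl /= bin0 mulr1 addr0.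
under [in RHS]eq_bigr => i _ do rewrite /bump /= add1n binS natrD mulrDr mulrDl.
rewrite big_split /= [RHS]addrA [RHS]addrC; congr +%R.
  apply: eq_bigr => i _; rewrite -natr1 addnS addSn !exprS !mulN1r opprK.
  by rewrite -addrA (addrC 1).
rewrite [in RHS]big_ord_recr /= bin_small// mulr0 mul0r addr0.
rewrite [in LHS]big_ord_recl /= bin0 mulr1 addr0 opprD; congr +%R.
  by rewrite !add0n exprS mulN1r mulNr.
rewrite -sumrN; apply: eq_bigr => i _; rewrite /bump /= add1n.
by rewrite [in RHS]addnS [in RHS]exprS mulN1r !mulNr.
Qed.

(** The remainder is linear in [f] and commutes with translations, hence with
    differences. *)
Lemma newton_rem_diff f N x a :
  newton_rem f N x (a + 1) - newton_rem f N x a =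
  newton_rem (fun y => f (y + 1) - f y) N x a.
Proof.
rewrite /newton_rem /newton.
under [in RHS]eq_bigr => n _ do rewrite fdiff_diff /= mulrBr.
by rewrite big_split /= sumrN (addrAC a); ring.
Qed.

Lemma eq_newton_rem f g N x a : 0 < a -> 0 < x ->
  (forall y, 0 < y -> f y = g y) -> newton_rem f N x a = newton_rem g N x a.
Proof.
move=> a0 x0 fg; rewrite /newton_rem /newton fg ?addr_gt0//; congr (_ - _).
by apply: eq_bigr => n _; rewrite (eq_fdiff _ a0 fg).
Qed.

Lemma risingSr n a : rising n.+1 a = rising n a * (a + n%:R).
Proof. by rewrite /rising big_ord_recr. Qed.

Lemma risingS n a : rising n.+1 a = a * rising n (a + 1).
Proof.
rewrite /rising big_ord_recl /= addr0; congr *%R; apply: eq_bigr => i _.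
by rewrite /bump /= add1n -natr1 -addrA (addrC 1).
Qed.

Lemma rising_gt0 n a : 0 < a -> 0 < rising n a.
Proof. by move=> a0; apply: prodr_gt0 => i _; rewrite ltr_pwDl. Qed.

Lemma fdiff_inv n a : 0 < a ->
  fdiff (fun y => y^-1) n a = (-1) ^+ n * n`!%:R / rising n.+1 a.
Proof.
elim: n a => [|n IHn] a a0 /=.
  by rewrite /rising big_ord_recl big_ord0 addr0 expr0 !mulr1 mul1r.
have a1 : 0 < a + 1 by rewrite addr_gt0.
rewrite !IHn// [in X in _ - X]risingS (risingSr n (a + 1)) (risingS n.+1 a).
rewrite (risingSr n (a + 1)) factS exprS natrM.
have := rising_gt0 n a1; set q := rising _ _ => q0.
have an : 0 < a + 1 + n%:R by rewrite ltr_pwDl.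
by rewrite -natr1; field; rewrite !gt_eqF.
Qed.

Lemma rbinomM n x : rbinom x n * n`!%:R = \prod_(i < n) (x - i%:R).
Proof.
by rewrite /rbinom big_mkord mulfVK// pnatr_eq0 -lt0n fact_gt0.
Qed.

(** Passing from degree [N] to degree [N + 1] multiplies the remainder by
    [(N + 1 - x) / (a + N + 1)]. *)
Lemma newton_rem_inv N x a : 0 < a -> 0 < x ->
  newton_rem (fun y => y^-1) N x a =
  (-1) ^+ N.+1 * (rbinom x N.+1 * N.+1`!%:R) / (rising N.+1 a * (a + x)).
Proof.
move=> a0 x0; have ax : 0 < a + x by rewrite addr_gt0.
rewrite /newton_rem /newton; elim: N => [|N IHN].
  rewrite rbinomM !big_ord_recl !big_ord0 /= /rising big_ord_recl big_ord0.
  rewrite /rbinom big_geq//= fact0 divr1 expr1 subr0 !addr0 !mulr1.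
  by field; rewrite !gt_eqF.
rewrite big_ord_recr /= opprD addrA IHN -/(fdiff _ N.+1 a) fdiff_inv//.
rewrite (risingSr N.+1) (rbinomM N.+2).
rewrite [in RHS]big_ord_recr /=.
have := rising_gt0 N.+1 a0; set q := rising _ _ => q0.
have an : 0 < a + N.+1%:R by rewrite ltr_pwDl.
rewrite -rbinomM (exprS _ N.+1); field.
by rewrite nat1r !gt_eqF.
Qed.

(** The factors [a + i] with [i >= 2] are at least [1 + i]; [a] and [a + 1] are
    kept as two powers of [a], without which the bounds on the remainder of [ln]
    at the positive integers would not be summable. *)
Lemma fact_le_rising N a : 1 <= a -> N.+2`!%:R * a ^+ 2 <= 2 * rising N.+2 a.
Proof.
move=> a1; elim: N => [|N IHN].
  rewrite /rising !big_ord_recl big_ord0 /= (_ : 2`! = 2%N)//.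
  by rewrite /bump /= addr0 mulr1; nra.
rewrite factS natrM risingSr -mulrA -natr1.
have := ler0n R N.+2.
have := rising_gt0 N.+2 (lt_le_trans ltr01 a1).
move: IHN; set q := rising _ _; set m := N.+2%:R; set b := _ * a ^+ 2.
move=> bq q0 m0; have : (m + 1) * b <= (m + 1) * (2 * q).
  by rewrite ler_wpM2l// addr_ge0.
by move/le_trans; apply; nra.
Qed.

End finite_differences.

(** * The Newton remainder of the logarithm *)

Section newton_series_of_ln.
Context {R : realType}.
Implicit Types (f df g : R -> R) (n N m : nat) (a x : R).

Lemma is_derive_fdiff f df n a : 0 < a ->
  (forall y : R, 0 < y -> is_derive y 1 f (df y)) ->
  is_derive a 1 (fdiff f n) (fdiff df n a).
Proof.
move=> + fdf; elim: n a => [|n IHn] a a0 /=; first exact: fdf.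
apply: is_deriveB; last exact: IHn.
have := @is_derive1_comp R _ (shift 1) a _ _ (IHn _ (addr_gt0 a0 ltr01))
  (is_derive_shift a 1 1).
by rewrite mulr1.
Qed.

Lemma is_derive_newton_rem f df N x a : 0 < a -> 0 < x ->
  (forall y : R, 0 < y -> is_derive y 1 f (df y)) ->
  is_derive a 1 (newton_rem f N x) (newton_rem df N x a).
Proof.
move=> a0 x0 fdf; rewrite /newton_rem; apply: is_deriveB.
  have := @is_derive1_comp R _ (shift x) a _ _ (fdf _ (addr_gt0 a0 x0))
    (is_derive_shift a 1 x).
  by rewrite mulr1.
rewrite (_ : newton f N x = \sum_(n < N.+1) (rbinom x n *: fdiff f n)).
  by apply: is_derive_sum => n; apply: is_deriveZ; exact: is_derive_fdiff.
by apply/funext => y; rewrite /newton fct_sumE.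
Qed.

Lemma newton_rem_inv_le N x a : 1 <= a -> 0 < x ->
  `|newton_rem (fun y => y^-1) N.+1 x a| <= 2 * `|rbinom x N.+2| / a ^+ 3.
Proof.
move=> a1 x0; have a0 := lt_le_trans ltr01 a1.
rewrite newton_rem_inv// normrM normrMsign normrM normfV.
rewrite [ `|N.+2`!%:R|]ger0_norm// (mulrC 2) -!mulrA ler_wpM2l//.
have q0 := rising_gt0 N.+2 a0.
rewrite gtr0_norm ?mulr_gt0 ?addr_gt0//.
rewrite ler_pdivlMr ?exprn_gt0// mulrAC ler_pdivrMr ?mulr_gt0 ?addr_gt0//.
rewrite exprSr !mulrA; apply: ler_pM; rewrite ?mulr_ge0 ?(ltW a0)//.
  by rewrite -mulrA; exact: fact_le_rising.
by rewrite lerDl ltW.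
Qed.

Lemma cvg_invn : m%:R^-1 @[m --> \oo] --> (0 : R).
Proof.
apply/gtr0_cvgV0; last exact: cvgr_idn.
by exists 1 => // m /= m0; rewrite ltr0n.
Qed.

Lemma ln_shift_cvg0 a c : 0 < a -> 0 <= c ->
  ln (a + m%:R + c) - ln (a + m%:R) @[m --> \oo] --> (0 : R).
Proof.
move=> a0 c0; apply: (@squeeze_cvgr _ _ _ _ (cst 0) (fun m => c * m%:R^-1)).
- near=> m; have m0 : 0 < m%:R :> R by rewrite ltr0n; near: m; exists 1.
  have am0 : 0 < a + m%:R by rewrite addr_gt0.
  rewrite -ln_div ?posrE ?(ltr_wpDr c0)//.
  rewrite mulrDl divff ?gt_eqF//.
  have cam : 0 <= c / (a + m%:R) by rewrite divr_ge0// ltW.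
  rewrite ln_ge0 ?lerDl//=; apply: le_trans (le_ln1Dx _) _.
    by rewrite (lt_le_trans _ cam).
  by rewrite ler_wpM2l// lef_pV2 ?posrE// lerDr ltW.
- exact: cvg_cst.
- by rewrite -(mulr0 c); apply: cvgMl_tmp; exact: cvg_invn.
Unshelve. all: by end_near. Qed.

Lemma fdiff_ln_cvg0 n a : 0 < a ->
  fdiff (@ln R) n.+1 (a + m%:R) @[m --> \oo] --> (0 : R).
Proof.
elim: n a => [|n IHn] a a0; first exact: ln_shift_cvg0.
rewrite /= -(subrr (0 : R)).
have a1 : 0 < a + 1 by rewrite addr_gt0.
apply: cvgB; last exact: IHn.
by have := IHn _ a1; under eq_cvg do rewrite addrAC.
Qed.

(** The linear part of the interpolation is where the growth of [f] at infinity
    enters; what remains is a fixed number of higher differences. *)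
Lemma newton_rem_cvg0 f N x a :
  (forall n, fdiff f n.+2 (a + m%:R) @[m --> \oo] --> (0 : R)) ->
  f (a + m%:R + x) - f (a + m%:R) - x * fdiff f 1 (a + m%:R)
    @[m --> \oo] --> (0 : R) ->
  newton_rem f N.+1 x (a + m%:R) @[m --> \oo] --> (0 : R).
Proof.
move=> fd f1.
rewrite (_ : (fun m => _) = (fun m => (f (a + m%:R + x) - f (a + m%:R) -
    x * fdiff f 1 (a + m%:R)) -
    \sum_(i < N) rbinom x i.+2 * fdiff f i.+2 (a + m%:R))); last first.
  apply/funext => m; rewrite /newton_rem /newton 2!big_ord_recl.
  rewrite {1}/rbinom big_geq//= fact0 divr1 mul1r.
  by rewrite {1}/rbinom big_nat1 subr0 divr1 opprD addrA opprD addrA.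
rewrite -[X in _ --> X](subrr (0 : R)); apply: cvgB; first exact: f1.
rewrite [X in _ --> X](_ : 0 = \sum_(i < N) rbinom x i.+2 * 0); last first.
  by rewrite big1// => i _; rewrite mulr0.
apply: cvg_big => [|i _]; first exact: add_continuous.
by apply: cvgMl_tmp; exact: fd.
Qed.

Lemma newton_rem_ln_cvg0 N x a : 0 < a -> 0 < x ->
  newton_rem (@ln R) N.+1 x (a + m%:R) @[m --> \oo] --> (0 : R).
Proof.
move=> a0 x0; apply: newton_rem_cvg0 => //; first by move=> n; apply: fdiff_ln_cvg0.
rewrite -[X in _ --> X](subrr (0 : R)); apply: cvgB.
  exact: ln_shift_cvg0 (ltW _).
rewrite -(mulr0 x); apply: cvgMl_tmp; exact: fdiff_ln_cvg0.
Qed.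

Lemma nonincreasing_cvg0_ge0 (h : R -> R) a : 0 < a ->
  (forall y, 0 < y ->  derivable h y 1) ->
  (forall y, a < y -> derive1 h y <= 0) ->
  h (a + m%:R) @[m --> \oo] --> (0 : R) -> 0 <= h a.
Proof.
move=> a0 dh h0 hlim; rewrite -(cvg_lim _ hlim)//.
apply: limr_le; first by apply/cvg_ex; exists 0.
apply: nearW => m; apply: (@ler0_derive1_nincry _ h a) => //.
- by move=> y; rewrite in_itv/= andbT => ay; apply: dh; rewrite (lt_trans a0).
- by move=> y; rewrite in_itv/= andbT; apply: h0.
- apply: derivable_within_continuous => y; rewrite in_itv/= andbT => ay.
  by apply: dh; rewrite (lt_le_trans a0).
- by rewrite lerDl.
Qed.

Lemma is_derive_invX2 (C y : R) : 0 < y ->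
  is_derive y 1 (fun y : R => C * y ^- 2) (- (2 * C / y ^+ 3)).
Proof.
move=> y0; have y2 : y ^+ 2 != 0 by rewrite expf_neq0// gt_eqF.
have dX : is_derive y 1 (fun y : R => y ^+ 2) (2 * y).
  by apply: is_derive_eq; rewrite /GRing.scale /=; ring.
have := @is_deriveZ R R R (fun y => y ^- 2) C y 1 _
  (@is_deriveV R (fun y => y ^+ 2) y _ 1 y2 dX).
move/is_derive_eq; apply; rewrite /GRing.scale /=.
by field; rewrite gt_eqF.
Qed.

(** Comparison with the primitive [- C / a ^ 2] of the bound
    [2 * C / a ^ 3] of [newton_rem_inv_le]: both [C / a ^ 2 + E a] and
    [C / a ^ 2 - E a] decrease to 0, where [E] is the remainder. *)
Lemma newton_rem_ln_le N x a : 1 <= a -> 0 < x ->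
  `|newton_rem (@ln R) N.+1 x a| <= `|rbinom x N.+2| / a ^+ 2.
Proof.
move=> a1 x0; have a0 := lt_le_trans ltr01 a1.
pose C : R := `|rbinom x N.+2|; rewrite -/C.
pose E := newton_rem (@ln R) N.+1 x; rewrite -/(E a).
have dE (y : R) : 0 < y -> is_derive y 1 E (newton_rem (fun y => y^-1) N.+1 x y).
  by move=> y0; apply: is_derive_newton_rem => // z; exact: is_derive1_ln.
have Elim := newton_rem_ln_cvg0 N a0 x0.
have hlim : C * (a + m%:R) ^- 2 @[m --> \oo] --> (0 : R).
  rewrite -(mulr0 C); apply: cvgMl_tmp.
  apply: (@squeeze_cvgr _ _ _ _ (cst 0) (fun m => m%:R^-1)).
  - near=> m; have m0 : 0 < m%:R :> R by rewrite ltr0n; near: m; exists 1.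
    have am1 : 1 <= a + m%:R by rewrite ler_wpDr.
    rewrite invr_ge0 sqr_ge0/= lef_pV2 ?posrE// ?exprn_gt0 ?addr_gt0//.
    by rewrite (@le_trans _ _ (a + m%:R))// ?lerDr ?(ltW a0)//
      expr2 ler_peMl// ltW// addr_gt0.
  - exact: cvg_cst.
  - exact: cvg_invn.
(* [s] is the sign of the remainder in the two comparisons *)
suff H s : `|s| = 1 -> 0 <= C * a ^- 2 + s * E a.
  have := H 1; have := H (-1); rewrite normrN normr1 => /(_ erefl) + /(_ erefl).
  by rewrite ler_norml; lra.
move=> s1.
have dh (y : R) : 0 < y -> is_derive y 1 (fun y => C * y ^- 2 + s * E y)
    (- (2 * C / y ^+ 3) + s * newton_rem (fun y => y^-1) N.+1 x y).
  move=> y0; apply: is_deriveD; first exact: is_derive_invX2.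
  by apply: is_deriveZ; exact: dE.
apply: (@nonincreasing_cvg0_ge0 (fun y => C * y ^- 2 + s * E y)) => //.
- by move=> y y0; apply: ex_derive; exact: dh.
- move=> y ay; have y0 := lt_trans a0 ay.
  rewrite derive1E (@derive_val _ _ _ _ _ _ _ (dh _ y0)) addrC subr_le0.
  apply: le_trans (ler_norm _) _; rewrite normrM s1 mul1r.
  by apply: newton_rem_inv_le => //; rewrite (le_trans a1)// ltW.
- rewrite -[X in _ --> X](addr0 (0 : R)); apply: cvgD => //.
  by rewrite -(mulr0 s); apply: cvgMl_tmp.
Unshelve. all: by end_near. Qed.

End newton_series_of_ln.

(** * Newton series of the solutions of [G (y + 1) = G y + ln y] *)

Section newton_series_of_ln_sum.
Context {R : realType}.
Implicit Types (n N m : nat) (a x : R).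

(** The remainder of [G] at 1 telescopes into the remainders of [ln] at
    [1, 2, 3, ...], whose bounds add up to at most twice the first one. *)
Lemma newton_rem_sum_le (G : R -> R) N x : 0 < x ->
  (forall y : R, 0 < y -> G (y + 1) = G y + ln y) ->
  newton_rem G N.+1 x (1 + m%:R) @[m --> \oo] --> (0 : R) ->
  `|newton_rem G N.+1 x 1| <= 2 * `|rbinom x N.+2|.
Proof.
move=> x0 GS Glim; pose C : R := `|rbinom x N.+2|; rewrite -/C.
have FS m : newton_rem G N.+1 x (1 + m.+1%:R) - newton_rem G N.+1 x (1 + m%:R) =
    newton_rem (@ln R) N.+1 x (1 + m%:R).
  have m1 : 0 < 1 + m%:R :> R by rewrite ltr_pwDl.
  rewrite -natr1 addrA newton_rem_diff; apply: eq_newton_rem => // y y0.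
  by rewrite GS// addrAC subrr add0r.
(* 1 - 1 / (m + 1) is the sum of 1 / (k (k + 1)) over 1 <= k <= m, and
   1 / k ^ 2 <= 2 / (k (k + 1)) *)
have Fle m : `|newton_rem G N.+1 x (1 + m%:R) - newton_rem G N.+1 x 1| <=
    2 * C * (1 - (m%:R + 1)^-1).
  elim: m => [|m IHm]; first by rewrite addr0 add0r invr1 !subrr normr0 mulr0.
  rewrite -[X in X - _](subrK (newton_rem G N.+1 x (1 + m%:R))) FS -addrA.
  apply: (le_trans (ler_normD _ _)).
  have m1 : 1 <= 1 + m%:R :> R by rewrite lerDl.
  have le1 := newton_rem_ln_le N m1 x0.
  apply: (le_trans (lerD le1 IHm)); rewrite -/C -[m.+1%:R]natr1 (addrC 1 m%:R).
  have C0 : 0 <= C by rewrite normr_ge0.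
  rewrite -subr_ge0; set k : R := m%:R.
  have k0 : 0 <= k by rewrite ler0n.
  have -> : 2 * C * (1 - (k + 1 + 1)^-1) - (C / (k + 1) ^+ 2 +
      2 * C * (1 - (k + 1)^-1)) = C * k / ((k + 1) ^+ 2 * (k + 1 + 1)).
    by field; rewrite !gt_eqF//; lra.
  by rewrite divr_ge0 ?mulr_ge0 ?sqr_ge0//; lra.
have {}Fle m : `|newton_rem G N.+1 x (1 + m%:R) - newton_rem G N.+1 x 1| <= 2 * C.
  by apply: le_trans (Fle m) _; rewrite ler_piMr ?mulr_ge0 ?normr_ge0//.
have lim : `|newton_rem G N.+1 x (1 + m%:R) - newton_rem G N.+1 x 1| @[m --> \oo]
    --> `|0 - newton_rem G N.+1 x 1|.
  by apply: cvg_norm; apply: cvgB => //; exact: cvg_cst.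
rewrite -normrN -sub0r -(cvg_lim _ lim)//; apply: limr_le.
  by apply/cvg_ex; eexists; exact: lim.
exact: nearW.
Qed.

Lemma rbinomS x n : rbinom x n.+1 = rbinom x n * ((x - n%:R) / n.+1%:R).
Proof.
by rewrite /rbinom big_nat_recr//= factS mulnC natrM invfM mulrACA.
Qed.

(** Beyond [x], the ratio of consecutive coefficients has absolute value
    [(n - x) / (n + 1) <= n / (n + 1)], so that [n * |rbinom x n|] decreases. *)
Lemma rbinom_cvg0 x : 0 < x -> rbinom x n @[n --> \oo] --> (0 : R).
Proof.
move=> x0; pose k := Num.truncn x; pose C : R := `|rbinom x k.+1| * k.+1%:R.
have bC n : (k.+1 <= n)%N -> `|rbinom x n| <= C * n%:R^-1.
  move=> kn; rewrite -ler_pdivrMr ?invr_gt0 ?ltr0n ?(leq_ltn_trans _ kn)//.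
  rewrite invrK; elim: n kn => [//|n IHn]; rewrite leq_eqVlt => /predU1P[<-//|].
  rewrite ltnS => kn; apply: le_trans (IHn kn).
  have nx : x <= n%:R.
    have /andP[_ /ltW xk] := Num.Theory.truncn_itv (ltW x0).
    by rewrite (le_trans xk)// ler_nat.
  rewrite rbinomS normrM -mulrA ler_wpM2l// normrM normfV.
  rewrite [ `|n.+1%:R|]ger0_norm// divfK ?pnatr_eq0//.
  by rewrite ler0_norm ?subr_le0// opprB lerBlDr lerDl ltW.
apply/norm_cvg0P.
apply: (@squeeze_cvgr _ _ _ _ (cst 0) (fun m => C * m%:R^-1)).
- by exists k.+1 => // n /= kn; rewrite normr_ge0 bC.
- exact: cvg_cst.
- by rewrite -(mulr0 C); apply: cvgMl_tmp; exact: cvg_invn.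
Qed.

Lemma fdiff_antidiff (G : R -> R) n a : 0 < a ->
  (forall y : R, 0 < y -> G (y + 1) = G y + ln y) ->
  fdiff G n.+1 a = fdiff (@ln R) n a.
Proof.
move=> a0 GS; rewrite -fdiff_diff; apply: eq_fdiff => // y y0.
by rewrite GS// addrAC subrr add0r.
Qed.

(** Let [s = 1 + m].  For [0 <= x <= 1], the one-sided estimate at [s] with
    increment [x] gives the upper bound 0; at [s + x] with increment [1 - x],
    and with the difference equation, it gives the lower bound
    [(x - 1) * (ln (s + x) - ln s)].  The difference equation then raises [x]
    by 1 at the cost of [ln (s + x) - ln s], which tends to 0. *)
Lemma antidiff_shift_cvg0 (G : R -> R) x : 0 <= x ->
  (forall s : R, 0 < s -> G (s + 1) = G s + ln s) ->
  (forall s y : R, 0 < s -> 0 <= y <= 1 -> G (s + y) <= y * ln s + G s) ->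
  G (1 + m%:R + x) - G (1 + m%:R) - x * ln (1 + m%:R) @[m --> \oo] --> (0 : R).
Proof.
move=> x0 GS Gle; have m1 m : 0 < 1 + m%:R :> R by rewrite ltr_pwDl.
suff H (n : nat) (y : R) : 0 <= y -> y <= n%:R + 1 ->
    G (1 + m%:R + y) - G (1 + m%:R) - y * ln (1 + m%:R) @[m --> \oo] --> (0 : R).
  apply: (H (Num.bound x)) => //.
  by rewrite (le_trans (ltW (archi_boundP x0)))// lerDl.
elim: n y => [|n IHn] y y0 yn.
  have y01 : 0 <= 1 - y <= 1 by apply/andP; split; lra.
  have y01' : 0 <= y <= 1 by apply/andP; split; lra.
  apply: (@squeeze_cvgr _ _ _ _
    (fun m => (y - 1) * (ln (1 + m%:R + y) - ln (1 + m%:R))) (cst 0)).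
  - apply: nearW => m; have s0 := m1 m; set s : R := 1 + m%:R in s0 *.
    have sy0 : 0 < s + y by rewrite ltr_wpDr.
    have up := Gle _ _ s0 y01'; have := Gle _ _ sy0 y01.
    rewrite -addrA subrKC GS// => lo.
    by apply/andP; split; rewrite /=; lra.
  - rewrite -[X in _ --> X](mulr0 (y - 1)); apply: cvgMl_tmp.
    exact: ln_shift_cvg0.
  - exact: cvg_cst.
have [y1|/ltW y1] := leP y 1.
  by apply: IHn => //; rewrite (le_trans y1)// lerDr.
have y10 : 0 <= y - 1 by rewrite subr_ge0.
rewrite (_ : (fun m => _) = (fun m =>
    (G (1 + m%:R + (y - 1)) - G (1 + m%:R) - (y - 1) * ln (1 + m%:R)) +
    (ln (1 + m%:R + (y - 1)) - ln (1 + m%:R)))).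
  rewrite -[X in _ --> X](addr0 (0 : R)); apply: cvgD.
    by apply: IHn => //; rewrite -natr1 in yn; rewrite lerBlDr.
  exact: ln_shift_cvg0.
apply/funext => m; have my0 := ltr_wpDr y10 (m1 m).
have -> : 1 + m%:R + y = 1 + m%:R + (y - 1) + 1 by ring.
by rewrite GS//; ring.
Qed.

(** The hypotheses determine [G] up to an additive constant, as in the theorem
    of Bohr and Mollerup, so that its values at the positive integers, which are
    all that the series contains, can recover it. *)
Lemma newton_series_cvg (G : R -> R) x : 0 < x ->
  (forall y : R, 0 < y -> G (y + 1) = G y + ln y) ->
  (forall s y : R, 0 < s -> 0 <= y <= 1 -> G (s + y) <= y * ln s + G s) ->
  newton G N x 1 @[N --> \oo] --> G (1 + x).
Proof.
move=> x0 GS Gle; have Glim := antidiff_shift_cvg0 (ltW x0) GS Gle.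
have m1 m : 0 < 1 + m%:R :> R by rewrite ltr_pwDl.
have Glim0 N : newton_rem G N.+1 x (1 + m%:R) @[m --> \oo] --> (0 : R).
  apply: newton_rem_cvg0 => [n|].
    by under eq_cvg do rewrite fdiff_antidiff//; exact: fdiff_ln_cvg0.
  by under eq_cvg do rewrite fdiff_antidiff//.
have rem0 : newton_rem G n x 1 @[n --> \oo] --> (0 : R).
  rewrite -cvg_shiftS; apply/norm_cvg0P.
  apply: (@squeeze_cvgr _ _ _ _ (cst 0) (fun N => 2 * `|rbinom x N.+2|)).
  - by apply: nearW => N; rewrite normr_ge0 newton_rem_sum_le.
  - exact: cvg_cst.
  - rewrite -(mulr0 2); apply: cvgMl_tmp; apply/norm_cvg0P.
    by have := rbinom_cvg0 x0; rewrite -cvg_shiftS -cvg_shiftS.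
have : G (1 + x) - newton_rem G N x 1 @[N --> \oo] --> G (1 + x) - 0.
  by apply: cvgB => //; exact: cvg_cst.
rewrite subr0; under eq_cvg do rewrite /newton_rem subKr.
exact.
Qed.

End newton_series_of_ln_sum.

(** * The Gamma function *)

Definition gamma_density (R : realType) (s t : R) : R :=
  t `^ (s - 1) * expR (- t).

Section gamma_function.
Context {R : realType}.
Implicit Types (n k : nat) (s t x : R).
Notation mu := (@lebesgue_measure R).
Local Notation posR := (`]0%R, +oo[%classic : set R).

(* Extended-real values let the functional equation be proved before
   integrability, which is then deduced from it. *)
Let IG s : \bar R := (\int[mu]_(t in `]0%R, +oo[) (gamma_density s t)%:E)%E.

Lemma gamma_density_ge0 s t : 0 <= gamma_density s t.
Proof. by rewrite mulr_ge0 ?powR_ge0 ?expR_ge0. Qed.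

Lemma measurable_gamma_density s (D : set R) : measurable_fun D (gamma_density s).
Proof.
apply: measurable_funTS; apply: measurable_funM; first exact: measurable_powR.
by apply: measurableT_comp => //; exact: measurable_expR.
Qed.

Lemma is_derive_expRN t : is_derive t 1 (fun t : R => expR (- t)) (- expR (- t)).
Proof.
have := @is_derive1_comp R (@expR R) -%R t _ _ (is_derive_expR _) (is_deriveNid _ _).
by rewrite mulrN1.
Qed.

Lemma gamma_density_by_parts s (a b : R) : 0 < a -> a < b ->
  (\int[mu]_(t in `[a, b]) (gamma_density (s + 1) t)%:E =
   (a `^ s * expR (- a) - b `^ s * expR (- b))%:E +
   \int[mu]_(t in `[a, b]) (s * gamma_density s t)%:E)%E.
Proof.
move=> a0 ab.
have gt0 (t : R) : t \in `[a, b] -> 0 < t.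
  by rewrite in_itv/= => /andP[+ _]; exact: lt_le_trans.
have dP (r t : R) : 0 < t -> is_derive t 1 (fun t : R => t `^ r) (r * t `^ (r - 1)).
  exact: is_derive1_powR.
have LR (F f : R -> R) : (forall t : R, 0 < t -> is_derive t 1 F (f t)) ->
    derivable_oo_LRcontinuous F a b /\ {in `]a, b[, F^`()%classic =1 f}.
  move=> dF; have cF (t : R) : 0 < t -> {for t, continuous F}.
    move=> t0; apply: differentiable_continuous; apply/derivable1_diffP.
    by apply: ex_derive; exact: dF.
  split; last first.
    move=> t /subset_itv_oo_cc /gt0 t0; rewrite derive1E.
    by rewrite (@derive_val _ _ _ _ _ _ _ (dF _ t0)).
  split.
  - by move=> t /subset_itv_oo_cc /gt0 t0; apply: ex_derive; exact: dF.
  - by apply: cvg_at_right_filter; exact: cF.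
  - by apply: cvg_at_left_filter; apply: cF; exact: lt_trans ab.
have cd (F f : R -> R) : (forall t : R, 0 < t -> is_derive t 1 F (f t)) ->
    {within `[a, b], continuous F}.
  move=> dF; apply: derivable_within_continuous => t /gt0 t0.
  by apply: ex_derive; exact: dF.
have de (t : R) : 0 < t -> is_derive t 1 (fun t : R => expR (- t)) (- expR (- t)).
  by move=> _; exact: is_derive_expRN.
have dde (t : R) : 0 < t -> is_derive t 1 (fun t : R => - expR (- t)) (expR (- t)).
  by move=> t0; rewrite -[X in is_derive _ _ _ X]opprK; apply: is_deriveN; exact: de.
have dd (t : R) : 0 < t ->
    is_derive t 1 (fun t : R => s * t `^ (s - 1)) (s * ((s - 1) * t `^ (s - 1 - 1))).
  by move=> t0; apply: is_deriveZ; exact: dP.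
have [Le De] := LR _ _ de; have [LP DP] := LR _ _ (dP s).
have := integration_by_parts ab (cd _ _ dde) Le De (cd _ _ dd) LP DP.
under eq_integral do rewrite mulrCA (mulrC (expR _)) -/(gamma_density s _).
under [in X in _ = X -> _]eq_integral do rewrite mulNr EFinN mulrC.
rewrite integral_ge0N; last first.
  by move=> t _; rewrite lee_fin mulr_ge0 ?powR_ge0 ?expR_ge0.
rewrite oppeK => ->.
rewrite addeA -EFinD !(mulrC (expR _)) -opprB addNr add0e.
by apply: eq_integral => t _; rewrite /gamma_density addrK.
Qed.

(** Since [t ^ (k + 1) / (k + 1)! <= expR t]. *)
Lemma powR_expRN_le s t k : 0 <= s -> s <= k%:R -> 1 <= t ->
  t `^ s * expR (- t) <= k.+1`!%:R * t^-1.
Proof.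
move=> s0 sk t1; have t0 := lt_le_trans ltr01 t1.
have tk : t `^ s <= t ^+ k by rewrite -powR_mulrn ?(ltW t0)// ler_powR.
rewrite expRN ler_pdivrMr ?expR_gt0// -mulrA mulrC -mulrA ler_pdivlMl//.
have := expR_ge1Dxn k (ltW t0).
have f0 : 0 < k.+1`!%:R :> R by rewrite ltr0n fact_gt0.
move=> le1; have {le1} : t ^+ k.+1 / k.+1`!%:R <= expR t.
  by apply: le_trans le1; rewrite lerDr.
rewrite ler_pdivrMr//; apply: le_trans.
by rewrite exprS ler_wpM2l// ltW.
Qed.

(* The intervals avoid 0, where the density is unbounded for s < 1; the offset
   2 makes them non-degenerate for every n. *)
Let inc n : set R := `[n.+2%:R^-1, n.+2%:R]%classic.

Let bigcup_inc : \bigcup_n inc n = `]0%R, +oo[%classic.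
Proof.
apply/seteqP; split => t /=.
  move=> [n _]; rewrite /inc /= !in_itv/= andbT => /andP[+ _].
  by apply: lt_le_trans; rewrite invr_gt0.
rewrite in_itv/= andbT => t0.
pose n := Num.bound (t + t^-1); exists n => //.
have ti0 : 0 < t^-1 by rewrite invr_gt0.
have tn : t + t^-1 < n%:R by apply: archi_boundP; rewrite addr_ge0 ?ltW.
have nn : n%:R <= n.+2%:R :> R by rewrite ler_nat -addn2 leq_addr.
rewrite /inc /= in_itv/= -[t in X in X && _]invrK lef_pV2 ?posrE//.
by apply/andP; split; lra.
Qed.

Let inc_nd : nondecreasing_seq inc.
Proof.
move=> m n mn; rewrite subsetEset => t; rewrite /inc /= !in_itv/=.
have mn2 : m.+2%:R <= n.+2%:R :> R by rewrite ler_nat.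
have le1 : n.+2%:R^-1 <= m.+2%:R^-1 :> R by rewrite lef_pV2 ?posrE.
by move=> /andP[/(le_trans le1) -> /le_trans ->].
Qed.

Let integral_inc_cvg (f : R -> R) : (forall t, 0 <= f t) ->
  measurable_fun setT f ->
  (\int[mu]_(t in inc n) (f t)%:E)%E @[n --> \oo] -->
  (\int[mu]_(t in `]0%R, +oo[) (f t)%:E)%E.
Proof.
move=> f0 mf; rewrite -bigcup_inc; apply: ge0_nondecreasing_set_cvg_integral => //.
- by move=> n; exact: measurable_itv.
- by move=> n; apply/measurable_EFinP; exact: measurable_funTS.
- by move=> n t _; rewrite lee_fin.
Qed.

Let IG_S s : 0 < s -> IG (s + 1) = (s%:E * IG s)%E.
Proof.
move=> s0.
have cA := integral_inc_cvg (gamma_density_ge0 (s + 1)) (@measurable_gamma_density _ _).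
have := integral_inc_cvg (gamma_density_ge0 s) (@measurable_gamma_density _ _).
have sfin : s%:E \is a fin_num by [].
move/(cvgeZl sfin) => cB.
pose r n : R := n.+2%:R^-1 `^ s * expR (- n.+2%:R^-1) - n.+2%:R `^ s * expR (- n.+2%:R).
have cinv : n.+2%:R^-1 @[n --> \oo] --> (0 : R).
  by have := @cvg_invn R; rewrite -cvg_shiftS -cvg_shiftS.
have cr : r n @[n --> \oo] --> (0 : R).
  rewrite -[X in _ --> X](subrr 0); apply: cvgB.
    apply: (@squeeze_cvgr _ _ _ _ (cst 0) (fun n => n.+2%:R^-1 `^ s)).
    - by apply: nearW => n; rewrite mulr_ge0 ?powR_ge0 ?expR_ge0//= ler_piMr ?powR_ge0//.
    - exact: cvg_cst.
    - by have /cvg_at_rightP := powR_cvg0 s0; apply; split.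
  pose k := Num.bound s.
  apply: (@squeeze_cvgr _ _ _ _ (cst 0) (fun n => k.+1`!%:R * n.+2%:R^-1)).
  - apply: nearW => n; rewrite mulr_ge0 ?powR_ge0 ?expR_ge0//=.
    apply: powR_expRN_le; rewrite ?(ltW s0) ?ler1n//.
    by apply/ltW/archi_boundP/ltW.
  - exact: cvg_cst.
  - by rewrite -(mulr0 k.+1`!%:R); apply: cvgMl_tmp.
have cAr : (\int[mu]_(t in inc n) (gamma_density (s + 1) t)%:E)%E @[n --> \oo] -->
    (0%:E + s%:E * IG s)%E.
  rewrite (_ : (fun n => _) = (fun n => ((r n)%:E +
      s%:E * \int[mu]_(t in inc n) (gamma_density s t)%:E)%E)); last first.
    apply/funext => n; rewrite gamma_density_by_parts//; last first.
      by rewrite (@lt_trans _ _ 1)// ?ltr1n// invf_lt1 ?ltr1n.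
    congr (_ + _)%E; under eq_integral do rewrite EFinM.
    rewrite ge0_integralZl_EFin ?(ltW s0)//.
    - by move=> t _; rewrite lee_fin gamma_density_ge0.
    - by apply/measurable_EFinP; exact: measurable_gamma_density.
  apply: cvgeD => //.
  by apply: cvg_EFin => //; exact: nearW.
by rewrite -[RHS]add0e; exact: (cvg_unique _ cA cAr).
Qed.

Let IG1 : IG 1 = 1%E.
Proof.
rewrite /IG; under eq_integral do rewrite /gamma_density subrr powRr0 mul1r.
rewrite integral_itv_obnd_cbnd; last first.
  apply/measurable_EFinP/measurable_funTS.
  by apply: measurableT_comp => //; exact: measurable_expR.
have de (t : R) : is_derive t 1 (fun t : R => - expR (- t)) (expR (- t)).
  by rewrite -[X in is_derive _ _ _ X]opprK; apply: is_deriveN; exact: is_derive_expRN.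
have ce (t : R) : {for t, continuous (fun t : R => expR (- t))}.
  apply: differentiable_continuous; apply/derivable1_diffP.
  by apply: ex_derive; exact: is_derive_expRN.
rewrite (@ge0_continuous_FTC2y _ _ (fun t => - expR (- t)) _ 0)//.
- by rewrite oppr0 expR0 sub0e -EFinN opprK.
- exact/continuous_subspaceT.
- by rewrite -oppr0; apply: cvgN; exact: cvgr_expR.
- by apply: cvg_at_right_filter; apply: cvgN; exact: ce.
- by move=> t _; rewrite derive1E (@derive_val _ _ _ _ _ _ _ (de t)).
Qed.

Let IG_ge0 s : (0 <= IG s)%E.
Proof. by apply: integral_ge0 => t _; rewrite lee_fin gamma_density_ge0. Qed.

Let IG_nat n : IG (n%:R + 1) = n`!%:R%:E.
Proof.
elim: n => [|n IHn]; first by rewrite add0r IG1.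
by rewrite -natr1 IG_S ?ltr_wpDl// IHn -EFinM natr1 factS natrM.
Qed.

Let mIG s : measurable_fun posR (EFin \o gamma_density s).
Proof. by apply/measurable_EFinP; exact: measurable_gamma_density. Qed.

(* By the functional equation it is enough to bound the integral at s + 1,
   where t ^ s <= 1 + t ^ k as soon as s <= k. *)
Let IG_lty s : 0 < s -> (IG s < +oo)%E.
Proof.
move=> s0; suff : (s%:E * IG s < +oo)%E.
  have := IG_ge0 s; case: (IG s) => [r _ _|_|//]; first exact: ltry.
  by rewrite gt0_muley ?lte_fin.
pose k := Num.bound s.
rewrite -IG_S//; apply: (@le_lt_trans _ _ (IG 1 + IG (k%:R + 1))%E); last first.
  by rewrite IG1 IG_nat -EFinD ltry.
rewrite -ge0_integralD//; first apply: ge0_le_integral => //.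
all: try by move=> t _; rewrite /= ?adde_ge0// lee_fin gamma_density_ge0.
all: try exact: mIG.
  by apply: emeasurable_funD; exact: mIG.
move=> t; rewrite /= in_itv/= andbT => t0.
rewrite -EFinD lee_fin /gamma_density subrr powRr0 !addrK -mulrDl.
rewrite ler_wpM2r ?expR_ge0//.
have [t1|/ltW t1] := leP t 1.
  rewrite (@le_trans _ _ 1)// ?lerDl ?powR_ge0//.
  rewrite [leRHS](_ : 1 = 1 `^ s); last by rewrite powR1.
  by apply: ge0_ler_powR; rewrite ?nnegrE ?(ltW s0) ?(ltW t0).
rewrite (@le_trans _ _ (t `^ k%:R))// ?lerDr//.
by rewrite ler_powR//; apply/ltW/archi_boundP/ltW.
Qed.

Lemma integrable_gamma_density s : 0 < s ->
  mu.-integrable posR (EFin \o gamma_density s).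
Proof.
move=> s0; apply/integrableP; split; first exact: mIG.
under eq_integral do rewrite /= ger0_norm ?gamma_density_ge0//.
exact: IG_lty.
Qed.

Lemma GammaS s : 0 < s -> Gamma (s + 1) = s * Gamma s.
Proof.
move=> s0; rewrite /Gamma /Rintegral -/(IG (s + 1)) -/(IG s) IG_S//.
by rewrite fineM// ge0_fin_numE ?IG_ge0 ?IG_lty.
Qed.

Lemma Gamma_nat n : Gamma (n%:R + 1 : R) = n`!%:R.
Proof. by rewrite /Gamma /Rintegral -/(IG (n%:R + 1)) IG_nat. Qed.

Lemma Gamma1 : Gamma (1 : R) = 1.
Proof. by have := Gamma_nat 0; rewrite add0r. Qed.

(** Concavity of [ln] at the mean [m] of [1] and [u] with weights [1 - x] and
    [x], in the form [ln y - ln m <= y / m - 1] for [y = 1] and [y = u]. *)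
Lemma powR_le_linear (u x : R) : 0 < u -> 0 <= x <= 1 -> u `^ x <= 1 - x + x * u.
Proof.
move=> u0 /andP[x0 x1].
have m0 : 0 < 1 - x + x * u by nra.
rewrite -ler_ln ?posrE ?powR_gt0// ln_powR.
set m := 1 - x + x * u in m0 *.
have lnle y : 0 < y -> ln y - ln m <= y / m - 1.
  move=> y0; rewrite -ln_div ?posrE//.
  have := @le_ln1Dx R (y / m - 1); rewrite subrKC; apply.
  by rewrite ltrBrDl subrr divr_gt0.
have h1 := ler_wpM2l x0 (lnle _ u0).
have x1' : 0 <= 1 - x by rewrite subr_ge0.
have := ler_wpM2l x1' (lnle _ ltr01); rewrite ln1 => h2.
have e : x * (u / m - 1) + (1 - x) * (1 / m - 1) = 0.
  by rewrite /m; field; rewrite gt_eqF.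
by have := lerD h1 h2; rewrite e; lra.
Qed.

(** Integrate [t ^ x <= s ^ x * (1 - x + x * t / s)] against the density of
    [Gamma s]: the integral of [t / s] is [Gamma (s + 1) / s = Gamma s], so the
    linear factor has mean 1. *)
Lemma Gamma_addr_le s x : 0 < s -> 0 <= x <= 1 ->
  Gamma (s + x) <= s `^ x * Gamma s.
Proof.
move=> s0 /[dup] x01 /andP[x0 x1].
have s1 : 0 < s + 1 by rewrite addr_gt0.
have sx : 0 < s + x by rewrite ltr_pwDl.
have i0 := integrable_gamma_density s0.
have i1 := integrable_gamma_density s1.
have ix := integrable_gamma_density sx.
pose g t := s `^ x * (1 - x) * gamma_density s t +
            s `^ x * (x / s) * gamma_density (s + 1) t.
have mD : @measurable _ (measurableTypeR R) posR by exact: measurable_itv.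
have igZ (c r : R) : 0 < r -> mu.-integrable posR
    (EFin \o (fun t => c * gamma_density r t)).
  move=> r0; have := integrableZl mD c (integrable_gamma_density r0).
  by apply: eq_integrable => // t _; rewrite /= EFinM.
have -> : s `^ x * Gamma s = \int[mu]_(t in `]0%R, +oo[) g t.
  rewrite /g RintegralD ?igZ// !RintegralZl//.
  rewrite -/(Gamma s) -/(Gamma (s + 1)) GammaS//.
  by field; rewrite gt_eqF.
apply: le_Rintegral => //.
  have := integrableD mD (igZ (s `^ x * (1 - x)) _ s0) (igZ (s `^ x * (x / s)) _ s1).
  by apply: eq_integrable => // t _; rewrite /= EFinD.
move=> t; rewrite /= in_itv/= andbT => t0.
have pD (u v : R) : t `^ (u + v) = t `^ u * t `^ v.
  by rewrite powRD // (gt_eqF t0) implybT.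
have ts : 0 < t / s by rewrite divr_gt0.
have e1 : t `^ (s + x - 1) = t `^ (s - 1) * (s `^ x * (t / s) `^ x).
  have st : s * (t / s) = t by rewrite mulrC divfK// gt_eqF.
  by rewrite -powRM ?(ltW s0) ?(ltW ts)// st addrAC -pD.
have e2 : t `^ (s + 1 - 1) = t `^ (s - 1) * t.
  by rewrite -[X in _ = _ * X](powRr1 (ltW t0)) -pD addrAC.
have := powR_le_linear ts x01.
have c0 : 0 <= t `^ (s - 1) * expR (- t) * s `^ x.
  by rewrite !mulr_ge0 ?powR_ge0 ?expR_ge0.
move=> /(ler_wpM2l c0); rewrite /g /gamma_density e1 e2.
set A := t `^ _; set E := expR _; set S := s `^ x; set T := (t / s) `^ x.
have -> : A * E * S * T = A * (S * T) * E by ring.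
by move/le_trans; apply; rewrite le_eqVlt; apply/orP; left; apply/eqP; ring.
Qed.

(** On [0 < s <= 1], [1 = Gamma 1 <= s ^ (1 - s) * Gamma s] excludes the value
    0; the functional equation does the rest. *)
Lemma Gamma_gt0 s : 0 < s -> 0 < Gamma s.
Proof.
suff H (n : nat) (r : R) : 0 < r -> r <= n.+1%:R -> 0 < Gamma r.
  move=> s0; apply: (H (Num.bound s) _ s0).
  by rewrite (le_trans (ltW (archi_boundP (ltW s0))))// ler_nat.
elim: n r => [|n IHn] r r0 rn.
  have := @Gamma_addr_le r (1 - r) r0; rewrite subrKC Gamma1.
  have -> : 0 <= 1 - r <= 1 by apply/andP; split; lra.
  move=> /(_ isT) le1; rewrite lt_neqAle eq_sym Rintegral_ge0 ?andbT; last first.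
    by move=> t _; exact: gamma_density_ge0.
  by apply: contraTneq le1 => ->; rewrite mulr0 -ltNge.
have [r1|r1] := leP r 1; first by apply: IHn => //; rewrite (le_trans r1)// ler1n.
rewrite -[r](subrK 1) GammaS ?subr_gt0// mulr_gt0 ?subr_gt0//.
by apply: IHn; rewrite ?subr_gt0// lerBlDr natr1.
Qed.

End gamma_function.

(** * The product as the exponential of a Newton series *)

Section log_gamma.
Context {R : realType}.
Implicit Types (n k N m : nat) (s x : R).

Lemma lnGammaS s : 0 < s -> ln (Gamma (s + 1)) = ln (Gamma s) + ln s.
Proof. by move=> s0; rewrite GammaS// lnM ?posrE ?Gamma_gt0// addrC. Qed.

Lemma lnGamma_addr_le s x : 0 < s -> 0 <= x <= 1 ->
  ln (Gamma (s + x)) <= x * ln s + ln (Gamma s).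
Proof.
move=> s0 /[dup] x01 /andP[x0 _]; have sx : 0 < s + x by rewrite ltr_pwDl.
have Gs := Gamma_gt0 s0; have Gsx := Gamma_gt0 sx.
have ps : 0 < s `^ x by rewrite powR_gt0.
have := Gamma_addr_le s0 x01; move: Gs Gsx.
move: (Gamma s) (Gamma (s + x)) => g h g0 h0.
by rewrite -ler_ln ?posrE ?mulr_gt0// lnM ?posrE// ln_powR.
Qed.

Lemma inner_prodE x n :
  inner_prod x n = expR (rbinom x n * fdiff (fun s => ln (Gamma s)) n 1).
Proof.
rewrite fdiffE big_ord_recl /= addr0 Gamma1 ln1 mulr0 add0r mulr_sumr expR_sum.
rewrite /inner_prod big_add1 big_mkord /=; apply: eq_bigr => k _.
rewrite /bump /= add1n (addrC 1 k.+1%:R) Gamma_nat.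
rewrite /powR pnatr_eq0 -[_ == 0%N]negbK -lt0n fact_gt0/=.
by congr expR; ring.
Qed.

Lemma partial_prodE x N :
  partial_prod x N = expR (newton (fun s => ln (Gamma s)) N x 1).
Proof.
rewrite /newton big_ord_recl /= Gamma1 ln1 mulr0 add0r expR_sum.
rewrite /partial_prod big_add1 big_mkord /=; apply: eq_bigr => k _.
by rewrite inner_prodE.
Qed.

Lemma partial_prod_cvg x : 0 < x ->
  partial_prod x N @[N --> \oo] --> Gamma (x + 1).
Proof.
move=> x0; under eq_cvg do rewrite partial_prodE.
have x1 : 0 < 1 + x by rewrite addr_gt0.
rewrite addrC -[Gamma _]lnK ?posrE ?Gamma_gt0//.
have := newton_series_cvg x0 lnGammaS lnGamma_addr_le.
by move/cvg_comp; apply; exact: continuous_expR.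
Qed.

(** The first difference of [ln Gamma] is [ln], so the base of the power is a
    product of integers with exponents the signed binomial coefficients of order
    [n]; the factors for [n + 1 = 1, 2, 3, 4] are computed from this form. *)
Lemma inner_prodSE x n :
  inner_prod x n.+1 = expR (rbinom x n.+1 * fdiff (@ln R) n 1).
Proof. by rewrite inner_prodE (fdiff_antidiff _ ltr01 lnGammaS). Qed.

End log_gamma.

Theorem theorem2p8 (R : realType) (x : R) (x_gt0 : 0 < x) :
  (cvgn (partial_prod x) /\
   Gamma x = 1 / x * limn (partial_prod x)) /\
  [/\ inner_prod x 1 = 1,
      inner_prod x 2 = (2 / 1) `^ rbinom x 2,
      inner_prod x 3 = (3 / 4) `^ rbinom x 3 &
      inner_prod x 4 = (32 / 27) `^ rbinom x 4].
Proof.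
split.
  have cvgP := partial_prod_cvg x_gt0; split.
    by apply/cvg_ex; exists (Gamma (x + 1)).
  by rewrite (cvg_lim _ cvgP)// GammaS// mulrA divfK ?gt_eqF// mul1r.
have powRE (c b l : R) : 0 < c -> ln c = l -> expR (b * l) = c `^ b.
  by move=> c0 <-; rewrite /powR gt_eqF.
have l4 : ln (1 + 1 + 1 + 1 : R) = 2 * ln 2.
  by rewrite (_ : 1 + 1 + 1 + 1 = 2 ^+ 2 :> R) ?lnXn// ?mulr_natl//; lra.
have l2 : 1 + 1 = 2 :> R by lra.
have l3 : 1 + 1 + 1 = 3 :> R by lra.
split.
- by rewrite inner_prodSE /= ln1 mulr0 expR0.
- rewrite inner_prodSE; apply: powRE; first lra.
  by rewrite /= ln1 subr0 l2 divr1.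
- rewrite inner_prodSE; apply: powRE; first lra.
  rewrite /= ln1 l3 l2 ln_div ?posrE// (_ : 4 = 2 ^+ 2 :> R) ?lnXn//; lra.
- rewrite inner_prodSE; apply: powRE; first lra.
  rewrite /= ln1 l4 l3 l2 ln_div ?posrE//.
  rewrite (_ : 32 = 2 ^+ 5 :> R); last by ring.
  rewrite (_ : 27 = 3 ^+ 3 :> R); last by ring.
  by rewrite !lnXn//; lra.
Qed.
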